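(* Let $\mathbb{G}$ be an $H$-type Iwasawa group, equipped with the distance $d(p,q)=\widetilde{d}(p^{-1}q)$ where $\widetilde{d}(x,t)=\left(|x|^4+16|t|^2\right)^{1/4}$ (extended to the one-point compactification $\widehat{\mathbb{G}}=\mathbb{G}\cup\{\infty\}$ by $d(p,\infty)=+\infty$ for $p\in\mathbb{G}$ and $d(\infty,\infty)=0$). Then the metric $d$ is Ptolemaean, and its Ptolemaean circles are $\mathbb{R}$-circles.
   Context: Let $\mathfrak{g}$ be a finite-dimensional real Lie algebra with an inner product $\langle\cdot,\cdot\rangle$, let $\mathfrak{j}$ be its center and $\mathfrak{b}$ the orthogonal complement of $\mathfrak{j}$. For $t\in\mathfrak{j}$ define $J_t:\mathfrak{b}\to\mathfrak{b}$ by $\langle J_t(x),y\rangle=\langle t,[x,y]\rangle$. $\mathfrak{g}$ is an $H$-type algebra if $[\mathfrak{b},\mathfrak{b}]=\mathfrak{j}$ and $J_t$ is orthogonal whenever $\langle t,t\rangle=1$. An $H$-type group is a connected, simply connected Lie group whose Lie algebra is $H$-type; it is an $H$-type Iwasawa group if for every $x\in\mathfrak{b}$ and all $t,t'\in\mathfrak{j}$ with $\langle t,t'\rangle=0$ there is $t''\in\mathfrak{j}$ with $J_t(J_{t'}(x))=J_{t''}(x)$. Points are written $p=\exp(x,t)$, identified with $(x,t)\in\mathfrak{b}\oplus\mathfrak{j}\cong\mathbb{R}^m\times\mathbb{R}^n$; the group law is $(x,t)(x',t')=(x+x',\,t+t'+\tfrac12[x,x'])$, and there are $m\times m$ skew-symmetric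 orthogonal matrices $U^1,\dots,U^n$ with $\tfrac12[x,x']=(\langle U^1x,x'\rangle,\dots,\langle U^nx,x'\rangle)$; $(x,t)^{-1}=(-x,-t)$. Dilations are $\delta_\lambda(x,t)=(\lambda x,\lambda^2t)$, $\lambda>0$. The inversion $\sigma:\mathbb{G}\setminus\{0\}\to\mathbb{G}\setminus\{0\}$ is $\sigma(x,t)=\left(-\frac{|x|^2x-4\sum_{k=1}^n U^kx}{|x|^4+16|t|^2},\,-\frac{t}{|x|^4+16|t|^2}\right)$, extended by $\sigma(0)=\infty$, $\sigma(\infty)=0$; left translations and dilations extend to $\widehat{\mathbb{G}}$ fixing $\infty$. The similarity group of $\widehat{\mathbb{G}}$ consists of compositions of left translations, dilations and $\sigma$. For $x\in\mathbb{R}^m\setminus\{0\}$ the standard $\mathbb{R}$-circle is $R_x=\{(\lambda x,0):\lambda\in\mathbb{R}\}$ (together with $\infty$); an $\mathbb{R}$-circle is the image of some $R_x$ under an element of the similarity group. A metric $d$ on a set $X$ is Ptolemaean if for any four distinct points $p_1,\dots,p_4\in X$ and any permutation $(i,j,k,l)$ of $(1,2,3,4)$: $d(p_i,p_k)d(p_j,p_l)\le d(p_i,p_j)d(p_k,p_l)+d(p_j,p_k)d(p_l,p_i)$. A subset $\Sigma\subset X$ is a Ptolemaean circle if for any four distinct points $p_1,p_2,p_3,p_4\in\Sigma$ such that $p_1,p_3$ separate $p_2,p_4$, one has $d(p_1,p_3)d(p_2,p_4)=d(p_1,p_2)d(p_3,p_4)+d(p_2,p_3)d(p_4,p_1)$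.
   Formalization: The bracket is [x,x']=(<U^k x,x'>) without the inconsistent factor 1/2, the inversion uses 4 sum t_k U^k x (missing t_k restored), Ptolemaean circles are taken homeomorphic to a circle, and infinite factors d(p,∞) are cancelled in Ptolemy relations. *)

(* Defs.v *)
From mathcomp Require Import all_boot all_order all_algebra.
From mathcomp Require Import reals.
Set Implicit Arguments.
Unset Strict Implicit.
Unset Printing Implicit Defensive.
Import Order.TTheory GRing.Theory Num.Theory.
Local Open Scope ring_scope.

Section HType.
Variables (R : realType) (m n : nat).

(* Points of G = exp(b + j), identified with (x,t) in R^m x R^n. *)
Definition pt := ('cV[R]_m * 'cV[R]_n)%type.
(* Points of the one-point compactification: None = infinity. *)
Definition ptc := option pt.

Definition dotv {k : nat} (u v : 'cV[R]_k) : R := \sum_(i < k) u i 0 * v i 0.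

Variable U : 'I_n -> 'M[R]_m.

Definition brk (x y : 'cV[R]_m) : 'cV[R]_n := \col_k dotv (U k *m x) y.

(* J_t, characterised by <J_t x, y> = <t,[x,y]>. *)
Definition Jop (t : 'cV[R]_n) : 'M[R]_m := \sum_(k < n) t k 0 *: U k.

Definition HtypeIwasawa : Prop :=
  (forall k, (U k)^T = - U k) /\
  (forall k, (U k)^T *m U k = 1%:M) /\
  (* j is exactly the centre (b has trivial intersection with the centre) *)
  (forall x, (forall y, brk x y = 0) -> x = 0) /\
  (* [b,b] = j *)
  (forall t, (forall x y, dotv t (brk x y) = 0) -> t = 0) /\
  (forall t, dotv t t = 1 -> (Jop t)^T *m Jop t = 1%:M) /\
  (forall (x : 'cV[R]_m) (t t' : 'cV[R]_n), dotv t t' = 0 ->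
     exists t'', Jop t *m (Jop t' *m x) = Jop t'' *m x).

Definition gmul (p q : pt) : pt := (p.1 + q.1, p.2 + q.2 + 2^-1 *: brk p.1 q.1).
Definition ginv (p : pt) : pt := (- p.1, - p.2).

Definition gauge (p : pt) : R :=
  Num.sqrt (Num.sqrt (dotv p.1 p.1 ^+ 2 + 16 * dotv p.2 p.2)).
Definition dist (p q : pt) : R := gauge (gmul (ginv p) q).

(* Distance factors on the compactification, with the standard convention that
   factors d(p,oo) = +oo cancel in the Ptolemy (in)equality: a factor involving
   oo (between a finite point and oo) is replaced by 1.  Each product in the
   Ptolemy relation contains exactly one factor involving a given point, so this
   is exactly the relation obtained after cancelling the infinite factors. *)
Definition wd (a b : ptc) : R :=
  match a, b with
  | Some p, Some q => dist p q
  | None, None => 0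
  | _, _ => 1
  end.

Definition distinct4 (a b c d : ptc) : Prop :=
  [/\ a <> b, a <> c, a <> d & [/\ b <> c, b <> d & c <> d]].

Definition Ptolemaean : Prop :=
  forall p1 p2 p3 p4 : ptc, distinct4 p1 p2 p3 p4 ->
    wd p1 p3 * wd p2 p4 <= wd p1 p2 * wd p3 p4 + wd p2 p3 * wd p4 p1.

(* Topology of the compactification: Euclidean on G, neighbourhoods of oo are
   complements of bounded sets. *)
Definition edist (p q : pt) : R :=
  Num.sqrt (dotv (p.1 - q.1) (p.1 - q.1) + dotv (p.2 - q.2) (p.2 - q.2)).
Definition enorm (p : pt) : R := Num.sqrt (dotv p.1 p.1 + dotv p.2 p.2).

Definition cont_at (g : R -> ptc) (s : R) : Prop :=
  match g s with
  | Some p => forall e : R, 0 < e -> exists2 del : R, 0 < del &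
       forall s', `|s' - s| < del -> exists q, g s' = Some q /\ edist q p < e
  | None => forall M : R, exists2 del : R, 0 < del &
       forall s', `|s' - s| < del ->
         match g s' with None => True | Some q => (M < enorm q : Prop) end
  end.

(* g : R -> Ghat is a 1-periodic continuous map injective on [0,1) whose image is S,
   i.e. g induces a homeomorphism of the circle R/Z onto S. *)
Definition circle_param (g : R -> ptc) (S : ptc -> Prop) : Prop :=
  [/\ (forall s, g (s + 1) = g s),
      (forall s, cont_at g s),
      (forall s s', 0 <= s < 1 -> 0 <= s' < 1 -> g s = g s' -> s = s') &
      (forall q, S q <-> exists s, 0 <= s < 1 /\ g s = q)].

(* On the circle parametrised by [0,1), the points with parameters s1, s3
   separate those with parameters s2, s4. *)
Definition separates (s1 s2 s3 s4 : R) : bool :=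
  (Num.min s1 s3 < s2 < Num.max s1 s3) != (Num.min s1 s3 < s4 < Num.max s1 s3).

Definition in01 (s : R) : Prop := 0 <= s < 1.

Definition ptolemaean_circle (S : ptc -> Prop) : Prop :=
  exists g, circle_param g S /\
    forall s1 s2 s3 s4, in01 s1 -> in01 s2 -> in01 s3 -> in01 s4 ->
      distinct4 (g s1) (g s2) (g s3) (g s4) -> separates s1 s2 s3 s4 ->
      wd (g s1) (g s3) * wd (g s2) (g s4)
        = wd (g s1) (g s2) * wd (g s3) (g s4) + wd (g s2) (g s3) * wd (g s4) (g s1).

Definition ltrans (a : pt) (p : ptc) : ptc :=
  match p with Some q => Some (gmul a q) | None => None end.
Definition dil (l : R) (p : ptc) : ptc :=
  match p with Some q => Some (l *: q.1, l ^+ 2 *: q.2) | None => None end.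
Definition sigma_fin (p : pt) : pt :=
  let D := dotv p.1 p.1 ^+ 2 + 16 * dotv p.2 p.2 in
  (- (D^-1 *: (dotv p.1 p.1 *: p.1 - 4 *: \sum_(k < n) p.2 k 0 *: (U k *m p.1))),
   - (D^-1 *: p.2)).
Definition sigma (p : ptc) : ptc :=
  match p with
  | Some q => if q == (0, 0) then None else Some (sigma_fin q)
  | None => Some (0, 0)
  end.

Inductive similarity : (ptc -> ptc) -> Prop :=
  | sim_id : similarity id
  | sim_tr a f : similarity f -> similarity (ltrans a \o f)
  | sim_dil l f : 0 < l -> similarity f -> similarity (dil l \o f)
  | sim_inv f : similarity f -> similarity (sigma \o f).

Definition std_Rcircle (x : 'cV[R]_m) (r : ptc) : Prop :=
  r = None \/ exists l : R, r = Some (l *: x, 0).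

Definition Rcircle (S : ptc -> Prop) : Prop :=
  exists f x, [/\ similarity f, x != 0 &
    forall q, S q <-> exists r, std_Rcircle x r /\ f r = q].

End HType.

(* Main.v *)
(* Write M(x,y) = <x,y>^2 + |[x,y]|^2.  Cauchy-Schwarz gives M(x,y) <= |x|^2 |y|^2,
   whence the triangle inequality for the gauge N, with equality N(pq) = N(p) + N(q)
   only on horizontal lines.  The J^2 condition makes M multiplicative,
   M((a + J_t)x, y) = (a^2 + |t|^2) M(x,y), and this is what is needed for
   d(sigma p, sigma q) = d(p,q) / (N(p) N(q)).  Ptolemy's relations are thus invariant
   under inversion, and sending one of the four points to infinity turns them into the
   triangle inequality.

   Given a Ptolemaean circle g, send g(0) to infinity and g(1/2) to the origin.  The
   images of g(s), s < 1/2, and of g(s'), s' > 1/2, satisfy the equality case of the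
   triangle inequality with the origin between them, so all lie on one horizontal
   line.  The gauge of the image of g(s) is, up to a constant, d(g(1/2),g(s)) /
   d(g(0),g(s)), which vanishes at s = 1/2 and blows up at s = 0 and s = 1; by the
   intermediate value theorem the whole line is covered. *)
Require Import Defs.
From mathcomp Require Import all_boot all_order all_algebra.
From mathcomp Require Import reals.
From mathcomp Require Import classical_sets.
From mathcomp Require Import ring lra.
Set Implicit Arguments.
Unset Strict Implicit.
Unset Printing Implicit Defensive.
Import Order.TTheory GRing.Theory Num.Theory.
Local Open Scope ring_scope.

(** * The Euclidean inner product *)

Section Dotv.
Variables (R : realType) (k : nat).
Implicit Types u v w : 'cV[R]_k.

Lemma dotvE u v : dotv u v = (u^T *m v) 0 0.
Proof. by rewrite mxE; apply: eq_bigr => i _; rewrite mxE. Qed.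

Lemma dotvC u v : dotv u v = dotv v u.
Proof. by apply: eq_bigr => i _; rewrite mulrC. Qed.

Lemma dotvDr u v w : dotv u (v + w) = dotv u v + dotv u w.
Proof. by rewrite !dotvE mulmxDr mxE. Qed.

Lemma dotvZr a u v : dotv u (a *: v) = a * dotv u v.
Proof. by rewrite !dotvE -scalemxAr mxE. Qed.

Lemma dotvNr u v : dotv u (- v) = - dotv u v.
Proof. by rewrite !dotvE mulmxN mxE. Qed.

Lemma dotvDl u v w : dotv (v + w) u = dotv v u + dotv w u.
Proof. by rewrite dotvC dotvDr !(dotvC u). Qed.

Lemma dotvZl a u v : dotv (a *: v) u = a * dotv v u.
Proof. by rewrite dotvC dotvZr dotvC. Qed.

Lemma dotvNl u v : dotv (- v) u = - dotv v u.
Proof. by rewrite dotvC dotvNr dotvC. Qed.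

Lemma dotv0r u : dotv u 0 = 0.
Proof. by rewrite dotvE mulmx0 mxE. Qed.

Lemma dotv0l u : dotv 0 u = 0.
Proof. by rewrite dotvC dotv0r. Qed.

Definition dotvL := (dotvDr, dotvDl, dotvNr, dotvNl, dotvZr, dotvZl).

Lemma dotv_ge0 u : 0 <= dotv u u.
Proof. by apply: sumr_ge0 => i _; rewrite -expr2 sqr_ge0. Qed.

Lemma dotv_eq0 u : (dotv u u == 0) = (u == 0).
Proof.
apply/idP/eqP => [|->]; last by rewrite dotv0l.
rewrite psumr_eq0 => [/allP h|i _]; last by rewrite -expr2 sqr_ge0.
apply/colP => i; rewrite mxE; apply/eqP.
by have := h i (mem_index_enum i); rewrite mulf_eq0 orbb.
Qed.

Lemma dotv_gt0 u : (0 < dotv u u) = (u != 0).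
Proof. by rewrite lt0r dotv_ge0 andbT dotv_eq0. Qed.

Lemma dotv_CS u v : dotv u v ^+ 2 <= dotv u u * dotv v v.
Proof.
have [->|u0] := eqVneq u 0; first by rewrite !dotv0l mul0r expr0n.
have := dotv_ge0 (dotv u u *: v - dotv u v *: u).
rewrite !dotvL (dotvC v u).
have : 0 < dotv u u by rewrite dotv_gt0.
move: (dotv u u) (dotv u v) (dotv v v) => a b c a0 h.
have : 0 <= a * (a * c - b ^+ 2) by move: h; congr (_ <= _); ring.
by rewrite pmulr_rge0 // subr_ge0.
Qed.

Lemma dotv_inj u v : (forall w, dotv w u = dotv w v) -> u = v.
Proof.
move=> h; apply/eqP; rewrite -subr_eq0 -dotv_eq0.
by rewrite dotvDr dotvNr h subrr.
Qed.

End Dotv.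

Lemma dotv_trmx (R : realType) (k l : nat) (A : 'M[R]_(l, k)) u v :
  dotv (A *m u) v = dotv u (A^T *m v).
Proof. by rewrite !dotvE trmx_mul mulmxA. Qed.

(** The zero is the supremum of the points of [a,b] where [h] is negative. Only openness of the two
    sign conditions is asked, not continuity: the functions of [pencil_ivt] may jump where the curve
    passes through oo. *)
Lemma sign_ivt (R : realType) (h : R -> R) (a b : R) : a < b ->
  h a < 0 -> 0 < h b ->
  (forall s, 0 < h s ->
     exists2 d, 0 < d & forall s', `|s' - s| < d -> 0 < h s') ->
  (forall s, h s < 0 ->
     exists2 d, 0 < d & forall s', `|s' - s| < d -> h s' < 0) ->
  exists2 c, a < c < b & h c = 0.
Proof.
move=> ab ha hb hpos hneg.
pose E := (fun s => a <= s <= b /\ h s < 0) : set R.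
have Ea : E a by rewrite /E lexx ltW.
have supE : has_sup E by split; [exists a|exists b => s [/andP[]]].
have ac : a <= sup E by apply: ub_le_sup Ea; case: supE.
have cb : sup E <= b by apply: ge_sup; [exists a|move=> s [/andP[]]].
set c := sup E in ac cb *.
have c0 : h c = 0.
  case: (ltgtP (h c) 0) => // hc.
    have [d d0 hd] := hneg _ hc.
    have cb' : c < b.
      rewrite lt_neqAle cb andbT.
      by apply: contraTneq hc => ->; rewrite -leNgt ltW.
    pose s := c + Num.min (b - c) (d / 2).
    have m0 : 0 < Num.min (b - c) (d / 2).
      by rewrite lt_min subr_gt0 cb' divr_gt0.
    have m1 : Num.min (b - c) (d / 2) <= b - c by rewrite ge_min lexx.
    have m2 : Num.min (b - c) (d / 2) <= d / 2 by rewrite ge_min lexx orbT.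
    have : s <= c.
      apply: ub_le_sup; first by case: supE.
      split; first by apply/andP; split; rewrite /s; lra.
      apply: hd; rewrite /s addrAC subrr add0r gtr0_norm //; lra.
    by rewrite /s; lra.
  have [d d0 hd] := hpos _ hc.
  have [s [s_ab hs] sc] := sup_adherent d0 supE.
  have sc' : s <= c by apply: ub_le_sup; [case: supE|split].
  have := hd s; rewrite distrC ger0_norm ?subr_ge0 // => /(_ _).
  by move/(_ ltac:(rewrite -/c in sc; lra)); lra.
exists c => //; rewrite !lt_neqAle ac cb !andbT; apply/andP; split.
  by apply: contraTneq ha => ->; rewrite c0 ltxx.
by apply: contraTneq hb => <-; rewrite c0 ltxx.
Qed.

(** * The bracket and the operators J_t *)

Section Algebra.
Variables (R : realType) (m n : nat) (U : 'I_n -> 'M[R]_m).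
Implicit Types (x y z : 'cV[R]_m) (s t : 'cV[R]_n) (p q r : pt R m n).

Lemma brkP t x y : dotv t (brk U x y) = dotv (Jop U t *m x) y.
Proof.
rewrite /Jop mulmx_suml [RHS]dotvC [RHS]dotvE mulmx_sumr summxE.
rewrite {1}/dotv; apply: eq_bigr => i _.
by rewrite mxE -scalemxAl -scalemxAr mxE -dotvE (dotvC y).
Qed.

Lemma brkDl x y z : brk U (x + y) z = brk U x z + brk U y z.
Proof. by apply/colP => k; rewrite !mxE mulmxDr dotvDl. Qed.

Lemma brkDr x y z : brk U z (x + y) = brk U z x + brk U z y.
Proof. by apply/colP => k; rewrite !mxE dotvDr. Qed.

Lemma brkNl x y : brk U (- x) y = - brk U x y.
Proof. by apply/colP => k; rewrite !mxE mulmxN dotvNl. Qed.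

Lemma brkNr x y : brk U x (- y) = - brk U x y.
Proof. by apply/colP => k; rewrite !mxE dotvNr. Qed.

Lemma brk0l x : brk U 0 x = 0.
Proof. by apply/colP => k; rewrite !mxE mulmx0 dotv0l. Qed.

Lemma brk0r x : brk U x 0 = 0.
Proof. by apply/colP => k; rewrite !mxE dotv0r. Qed.

Lemma JopD s t x : Jop U (s + t) *m x = Jop U s *m x + Jop U t *m x.
Proof.
rewrite -mulmxDl; congr (_ *m _).
rewrite /Jop -big_split; apply: eq_bigr => i _.
by rewrite mxE scalerDl.
Qed.

Lemma JopZ a t x : Jop U (a *: t) *m x = a *: (Jop U t *m x).
Proof.
rewrite scalemxAl; congr (_ *m _).
by rewrite /Jop scaler_sumr; apply: eq_bigr => i _; rewrite mxE scalerA.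
Qed.

Lemma JopN t x : Jop U (- t) *m x = - (Jop U t *m x).
Proof. by rewrite -scaleN1r JopZ scaleN1r. Qed.

Lemma Jop0 x : Jop U 0 *m x = 0.
Proof. by rewrite -(scale0r (0 : 'cV[R]_n)) JopZ scale0r. Qed.

Hypothesis HU : HtypeIwasawa U.

Lemma Jop_skew t x y : dotv (Jop U t *m x) y = - dotv x (Jop U t *m y).
Proof.
case: HU => hT _; rewrite dotv_trmx -dotvNr -mulNmx.
congr (dotv _ (_ *m _)); rewrite /Jop linear_sum -sumrN /=.
by apply: eq_bigr => i _; rewrite linearZ /= hT scalerN.
Qed.

(** Orthogonality of J_t is given for unit t only, so t is first normalised; combined with skewness
    it gives J_t^2 = -|t|^2. *)
Lemma JopJop t x : Jop U t *m (Jop U t *m x) = - (dotv t t *: x).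
Proof.
have [->|t0] := eqVneq t 0.
  by rewrite Jop0 dotv0l scale0r oppr0.
case: HU => _ [_ [_ [_ [hJ _]]]].
have t2 : 0 < dotv t t by rewrite dotv_gt0.
pose c := Num.sqrt (dotv t t).
have c0 : 0 < c by rewrite sqrtr_gt0.
have c2 : c * c = dotv t t by rewrite -expr2 sqr_sqrtr // ltW.
have u1 : dotv (c^-1 *: t) (c^-1 *: t) = 1.
  by rewrite !dotvL -c2; field; rewrite gt_eqF.
apply: dotv_inj => w.
have /(congr1 (fun A => dotv w (A *m x))) := hJ _ u1.
rewrite mul1mx -mulmxA -dotv_trmx !JopZ !dotvL Jop_skew -c2 => <-.
by field; rewrite gt_eqF.
Qed.

Lemma Jop_norm t x : dotv (Jop U t *m x) (Jop U t *m x) = dotv t t * dotv x x.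
Proof. by rewrite Jop_skew JopJop !dotvL opprK. Qed.

Lemma dotv_Jop0 t x : dotv x (Jop U t *m x) = 0.
Proof. by have := Jop_skew t x x; rewrite dotvC; lra. Qed.

Lemma brkC x y : brk U y x = - brk U x y.
Proof.
by apply: dotv_inj => t; rewrite dotvNr !brkP Jop_skew dotvC.
Qed.

Lemma brkxx x : brk U x x = 0.
Proof. by apply: dotv_inj => t; rewrite brkP dotv0r dotvC dotv_Jop0. Qed.

(** * The operators a + J_t and the multiplicative form M *)

Definition cliff (a : R) t x := a *: x + Jop U t *m x.

Lemma cliff_norm a t x :
  dotv (cliff a t x) (cliff a t x) = (a ^+ 2 + dotv t t) * dotv x x.
Proof.
rewrite /cliff !dotvL Jop_norm (dotvC (_ *m x)) dotv_Jop0; ring.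
Qed.

Lemma cliffE a t x y :
  dotv (cliff a t x) y = a * dotv x y + dotv t (brk U x y).
Proof. by rewrite brkP dotvDl dotvZl. Qed.

Lemma cliff_conj a t x :
  cliff a (- t) (cliff a t x) = (a ^+ 2 + dotv t t) *: x.
Proof.
rewrite /cliff mulmxDr -scalemxAr !JopN JopJop.
rewrite opprK scalerDr scalerN scalerA expr2 scalerDl.
by rewrite -!addrA; congr (_ + _); rewrite addrA subrr add0r.
Qed.

(** The J^2 condition covers J_t J_s for orthogonal t and s. In general, subtract from t its
    projection [k *: s] on s, which contributes only the scalar -k|s|^2. The resulting [c] and [u]
    depend on x. *)
Lemma cliff_cliff a t b s x :
  exists c u, cliff a t (cliff b s x) = cliff c u x.
Proof.
case: HU => _ [_ [_ [_ [_ hI]]]].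
have [c [u h]] : exists c u, Jop U t *m (Jop U s *m x) = cliff c u x.
  have [->|s0] := eqVneq s 0.
    by exists 0, 0; rewrite /cliff !Jop0 scale0r mulmx0 addr0.
  have s2 : dotv s s != 0 by rewrite dotv_eq0.
  pose k := dotv t s / dotv s s.
  have h0 : dotv (t - k *: s) s = 0 by rewrite !dotvL /k; field.
  have [u hu] := hI x _ _ h0.
  exists (- (k * dotv s s)), u.
  rewrite /cliff -hu -[X in Jop U X *m _ = _](subrK (k *: s) t).
  by rewrite (JopD (t - _)) (JopZ k) JopJop addrC scalerN scalerA scaleNr.
exists (a * b + c), (a *: s + b *: t + u).
rewrite /cliff mulmxDr -scalemxAr h /cliff !JopD !JopZ.
rewrite !scalerDr !scalerDl !scalerA -!addrA; congr (_ + _).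
by rewrite [RHS]addrCA; congr (_ + _); exact: addrCA.
Qed.

(** The form M(x,y). *)
Definition pairing x y := dotv x y ^+ 2 + dotv (brk U x y) (brk U x y).

Lemma pairingC x y : pairing x y = pairing y x.
Proof. by rewrite /pairing dotvC (brkC y) !dotvL opprK. Qed.

Lemma pairing_ge0 x y : 0 <= pairing x y.
Proof. by rewrite addr_ge0 ?sqr_ge0 ?dotv_ge0. Qed.

Lemma pairing_cliff x y :
  pairing x y = dotv (cliff (dotv x y) (brk U x y) x) y.
Proof. by rewrite cliffE. Qed.

(** M(x,y) is the inner product with y of a vector of squared norm M(x,y)|x|^2. Cauchy-Schwarz gives
    M^2 <= M|x|^2|y|^2, and a factor M cancels. *)
Lemma pairing_le x y : pairing x y <= dotv x x * dotv y y.
Proof.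
have := dotv_CS (cliff (dotv x y) (brk U x y) x) y.
rewrite -pairing_cliff cliff_norm -/(pairing x y).
have := pairing_ge0 x y; rewrite le0r => /orP[/eqP-> _|M0].
  by rewrite mulr_ge0 ?dotv_ge0.
by rewrite -mulrA expr2 ler_pM2l.
Qed.

Lemma CS_pair a b s t :
  (a * b + dotv s t) ^+ 2 <= (a ^+ 2 + dotv s s) * (b ^+ 2 + dotv t t).
Proof.
have := dotv_CS s t; have := dotv_ge0 (a *: t - b *: s).
rewrite !dotvL (dotvC t s).
move: (dotv s s) (dotv t t) (dotv s t) => ss tt st; nra.
Qed.

Lemma pairing0l y : pairing 0 y = 0.
Proof. by rewrite /pairing brk0l !dotv0l expr0n addr0. Qed.

Lemma pairingZl a x y : pairing (a *: x) y = a ^+ 2 * pairing x y.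
Proof.
have e : brk U (a *: x) y = a *: brk U x y.
  by apply/colP => k; rewrite !mxE -scalemxAr dotvZl.
by rewrite /pairing e !dotvL; ring.
Qed.

(* By the J^2 condition, [cliff c u z] with [z = cliff a t x] is again of the form
   [cliff c' u' x]; comparing norms bounds (c', u'), and [pairing z y] is the inner
   product of such a vector with [y]. *)
Lemma pairing_cliffl_le a t x y :
  pairing (cliff a t x) y <= (a ^+ 2 + dotv t t) * pairing x y.
Proof.
have [->|x0] := eqVneq x 0.
  have -> : cliff a t 0 = 0 by rewrite /cliff scaler0 mulmx0 addr0.
  by rewrite pairing0l mulr0.
set z := cliff a t x; set N := a ^+ 2 + _.
have [c [u e]] := cliff_cliff (dotv z y) (brk U z y) a t x.
have := congr1 (fun v => dotv v v) e; rewrite !cliff_norm -/(pairing z y) -/N.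
rewrite mulrA => /(mulIf _) e2.
have {}e2 : pairing z y * N = c ^+ 2 + dotv u u by apply: e2; rewrite dotv_eq0.
have eM : pairing z y = c * dotv x y + dotv u (brk U x y).
  by rewrite pairing_cliff e cliffE.
have := CS_pair c (dotv x y) u (brk U x y).
rewrite -eM -e2 -/(pairing x y).
have := pairing_ge0 z y; rewrite le0r => /orP[/eqP-> _|M0].
  by rewrite mulr_ge0 ?pairing_ge0 ?addr_ge0 ?sqr_ge0 ?dotv_ge0.
by rewrite -mulrA expr2 ler_pM2l.
Qed.

(** The reverse inequality is [pairing_cliffl_le] applied to the conjugate a - J_t, since (a -
    J_t)(a + J_t) is the scalar a^2 + |t|^2. *)
Lemma pairing_cliffl a t x y :
  pairing (cliff a t x) y = (a ^+ 2 + dotv t t) * pairing x y.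
Proof.
apply/eqP; rewrite eq_le pairing_cliffl_le /=.
set N := a ^+ 2 + _.
have : 0 <= N by rewrite addr_ge0 ?sqr_ge0 ?dotv_ge0.
rewrite le0r => /orP[/eqP->|N0]; first by rewrite mul0r pairing_ge0.
have := pairing_cliffl_le a (- t) (cliff a t x) y.
rewrite cliff_conj pairingZl !dotvL opprK -/N.
by rewrite expr2 -mulrA ler_pM2l.
Qed.

Lemma pairing_cliff2 a s b t x y : pairing (cliff a s x) (cliff b t y) =
  (a ^+ 2 + dotv s s) * (b ^+ 2 + dotv t t) * pairing x y.
Proof. by rewrite pairing_cliffl pairingC pairing_cliffl pairingC mulrA. Qed.

(** * The gauge and its triangle inequality *)

Definition gauge4 p : R := dotv p.1 p.1 ^+ 2 + 16 * dotv p.2 p.2.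

Lemma gauge4_ge0 p : 0 <= gauge4 p.
Proof. by rewrite addr_ge0 ?sqr_ge0 ?mulr_ge0 ?dotv_ge0. Qed.

Lemma gauge_ge0 p : 0 <= gauge p.
Proof. exact: sqrtr_ge0. Qed.

Lemma gauge_sqr2 p : (gauge p ^+ 2) ^+ 2 = gauge4 p.
Proof. by rewrite sqr_sqrtr ?sqrtr_ge0 // sqr_sqrtr // gauge4_ge0. Qed.

Lemma gauge4_eq0 p : (gauge4 p == 0) = (p == (0, 0)).
Proof.
rewrite paddr_eq0 ?sqr_ge0 ?mulr_ge0 ?dotv_ge0 //.
by rewrite sqrf_eq0 mulf_eq0 !dotv_eq0 pnatr_eq0; case: p => a b.
Qed.

Lemma gauge_eq0 p : (gauge p == 0) = (p == (0, 0)).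
Proof. by rewrite -gauge4_eq0 -gauge_sqr2 !sqrf_eq0. Qed.

Lemma gauge_gt0 p : (0 < gauge p) = (p != (0, 0)).
Proof. by rewrite lt0r gauge_ge0 andbT gauge_eq0. Qed.

Lemma gauge_eq p (a : R) : 0 <= a -> gauge4 p = (a ^+ 2) ^+ 2 -> gauge p = a.
Proof.
move=> a0 h; rewrite /gauge -/(gauge4 p) h.
by rewrite sqrtr_sqr ger0_norm ?sqr_ge0 // sqrtr_sqr ger0_norm.
Qed.

Lemma dotv1_le_gauge p : dotv p.1 p.1 <= gauge p ^+ 2.
Proof.
rewrite -ler_sqr ?nnegrE ?dotv_ge0 ?sqr_ge0 // gauge_sqr2 lerDl.
by rewrite mulr_ge0 ?dotv_ge0.
Qed.

Lemma gauge_ginv p : gauge (ginv p) = gauge p.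
Proof. by rewrite /gauge /= !dotvL !opprK. Qed.

Lemma gmulA p q r : gmul U (gmul U p q) r = gmul U p (gmul U q r).
Proof.
rewrite /gmul /= brkDl brkDr !scalerDr !addrA; congr (_, _).
rewrite -!addrA; do 2 congr (_ + _); rewrite addrCA; congr (_ + _).
by rewrite addrA [RHS]addrC.
Qed.

Lemma gmul0 p : gmul U p (0, 0) = p.
Proof. by case: p => x t; rewrite /gmul /= brk0r scaler0 !addr0. Qed.

Lemma gmul0l p : gmul U (0, 0) p = p.
Proof. by case: p => x t; rewrite /gmul /= brk0l scaler0 !add0r addr0. Qed.

Lemma gmulVg p : gmul U (ginv p) p = (0, 0).
Proof. by rewrite /gmul /= brkNl brkxx oppr0 scaler0 addr0 !addNr. Qed.

Lemma gmulgV p : gmul U p (ginv p) = (0, 0).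
Proof. by rewrite /gmul /= brkNr brkxx oppr0 scaler0 addr0 !addrN. Qed.

Lemma ginvM p q : ginv (gmul U p q) = gmul U (ginv q) (ginv p).
Proof.
rewrite /gmul /ginv /= brkNl brkNr opprK brkC scalerN !opprD.
by rewrite opprK (addrC (- p.1)) (addrC (- p.2)).
Qed.

Lemma ginvK p : ginv (ginv p) = p.
Proof. by case: p => x t; rewrite /ginv /= !opprK. Qed.

Lemma gmulKV p q : gmul U p (gmul U (ginv p) q) = q.
Proof. by rewrite -gmulA gmulgV gmul0l. Qed.

Lemma gmulVK p q : gmul U (ginv p) (gmul U p q) = q.
Proof. by rewrite -gmulA gmulVg gmul0l. Qed.

Lemma dist_gmul r p q : dist U (gmul U r p) (gmul U r q) = dist U p q.
Proof. by rewrite /dist ginvM gmulA gmulVK. Qed.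

Lemma dist_sym p q : dist U p q = dist U q p.
Proof. by rewrite /dist -gauge_ginv ginvM ginvK. Qed.

Lemma dist0l p : dist U (0, 0) p = gauge p.
Proof. by rewrite /dist /ginv /= !oppr0 gmul0l. Qed.

Lemma dist0r p : dist U p (0, 0) = gauge p.
Proof. by rewrite dist_sym dist0l. Qed.

Lemma dist_eq0 p q : (dist U p q == 0) = (p == q).
Proof.
rewrite gauge_eq0; apply/eqP/eqP => [h|->]; last exact: gmulVg.
by rewrite -[q](gmulKV p) h gmul0.
Qed.

Lemma dist_ge0 p q : 0 <= dist U p q.
Proof. exact: gauge_ge0. Qed.

Lemma dist_gt0 p q : (0 < dist U p q) = (p != q).
Proof. by rewrite lt0r dist_ge0 andbT dist_eq0. Qed.

(** The squares (2<x,y>)^2 and 16|[x,y]/2|^2 add up to 4M(x,y), which is how M enters the gauge of a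
    product. *)
Lemma gauge4_gmul p q : gauge4 (gmul U p q) =
  gauge4 p + gauge4 q + 2 * dotv p.1 p.1 * dotv q.1 q.1 + 32 * dotv p.2 q.2
  + 4 * pairing p.1 q.1 + 4 * dotv p.1 q.1 * (dotv p.1 p.1 + dotv q.1 q.1)
  + 16 * dotv (p.2 + q.2) (brk U p.1 q.1).
Proof.
rewrite /gauge4 /gmul /pairing /= !dotvL (dotvC q.1 p.1) (dotvC q.2 p.2).
rewrite (dotvC (brk _ _ _) p.2) (dotvC (brk _ _ _) q.2).
by field.
Qed.

Lemma gauge4_ginv p : gauge4 (ginv p) = gauge4 p.
Proof. by rewrite /gauge4 /= !dotvL !opprK. Qed.

Lemma sqrt_dotv1_le_gauge p : Num.sqrt (dotv p.1 p.1) <= gauge p.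
Proof.
rewrite -ler_sqr ?nnegrE ?sqrtr_ge0 ?gauge_ge0 //.
by rewrite sqr_sqrtr ?dotv_ge0 // dotv1_le_gauge.
Qed.

Lemma CS_pair_norm (a b A B : R) s t : 0 <= A -> 0 <= B ->
  A ^+ 2 = a ^+ 2 + dotv s s -> B ^+ 2 = b ^+ 2 + dotv t t ->
  a * b + dotv s t <= A * B.
Proof.
move=> A0 B0 eA eB; have := CS_pair a b s t; rewrite -eA -eB -exprMn => h.
rewrite (le_trans (ler_norm _)) // -ler_sqr ?nnegrE ?mulr_ge0 //.
by rewrite real_normK ?num_real.
Qed.

(* In R + R^n, the vector (|x+y|^2, 4(t+s+[x,y]/2)) is the sum of (|x|^2, 4t),
   (|y|^2, 4s) and 2(<x,y>, [x,y]), the last of length at most 2|x||y|. *)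
Lemma gauge_gmul_sharp p q : gauge (gmul U p q) ^+ 2 <=
  gauge p ^+ 2 + gauge q ^+ 2 + 2 * Num.sqrt (pairing p.1 q.1).
Proof.
set w := Num.sqrt _.
have w0 : 0 <= w by exact: sqrtr_ge0.
have wE : w ^+ 2 = pairing p.1 q.1 by rewrite sqr_sqrtr ?pairing_ge0.
have g0 r : 0 <= gauge r ^+ 2 by exact: sqr_ge0.
rewrite -ler_sqr ?nnegrE ?addr_ge0 ?mulr_ge0 ?gauge_ge0 //.
rewrite gauge_sqr2 gauge4_gmul -wE -!gauge_sqr2.
have gE r :
    (gauge r ^+ 2) ^+ 2 = dotv r.1 r.1 ^+ 2 + dotv (4 *: r.2) (4 *: r.2).
  by rewrite gauge_sqr2 /gauge4 !dotvL; ring.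
have := CS_pair_norm (g0 p) (g0 q) (gE p) (gE q).
have := CS_pair_norm (g0 p) w0 (gE p) wE.
have := CS_pair_norm (g0 q) w0 (gE q) wE.
rewrite !dotvL.
move: (gauge p ^+ 2) (gauge q ^+ 2) => A B h1 h2 h3; nra.
Qed.

Lemma sqrt_pairing_le x y :
  Num.sqrt (pairing x y) <= Num.sqrt (dotv x x) * Num.sqrt (dotv y y).
Proof. by rewrite -sqrtrM ?dotv_ge0 // ler_wsqrtr // pairing_le. Qed.

Lemma gauge_gmul_le p q : gauge (gmul U p q) <= gauge p + gauge q.
Proof.
rewrite -ler_sqr ?nnegrE ?addr_ge0 ?gauge_ge0 //.
apply: (le_trans (gauge_gmul_sharp p q)).
have := sqrt_pairing_le p.1 q.1.
have := @ler_pM R _ _ _ _ (sqrtr_ge0 _) (sqrtr_ge0 _)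
  (sqrt_dotv1_le_gauge p) (sqrt_dotv1_le_gauge q).
rewrite sqrrD; lra.
Qed.

Lemma dist_triangle r p q : dist U p q <= dist U p r + dist U r q.
Proof.
rewrite {1}/dist -{1}(gmulKV r q) -gmulA; exact: gauge_gmul_le.
Qed.

Lemma gauge_gmul_eq p q : p != (0, 0) -> q != (0, 0) ->
  gauge (gmul U p q) = gauge p + gauge q ->
  [/\ p.2 = 0, p.1 != 0 & exists2 c, 0 < c & q = (c *: p.1, 0)].
Proof.
rewrite -!gauge_gt0 => p0 q0 e.
have := gauge_gmul_sharp p q; rewrite e.
set X := Num.sqrt (dotv p.1 p.1); set Y := Num.sqrt (dotv q.1 q.1).
have X0 : 0 <= X by exact: sqrtr_ge0.
have Y0 : 0 <= Y by exact: sqrtr_ge0.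
have X2 : X ^+ 2 = dotv p.1 p.1 by rewrite sqr_sqrtr ?dotv_ge0.
have Y2 : Y ^+ 2 = dotv q.1 q.1 by rewrite sqr_sqrtr ?dotv_ge0.
have hX : X <= gauge p := sqrt_dotv1_le_gauge p.
have hY : Y <= gauge q := sqrt_dotv1_le_gauge q.
have hw : Num.sqrt (pairing p.1 q.1) <= X * Y := sqrt_pairing_le p.1 q.1.
rewrite sqrrD => h.
(* The bounds give N(p)N(q) <= XY with X <= N(p) and Y <= N(q); as N(p) and N(q) are positive, both
   are equalities, and the vertical parts vanish. *)
have eX : X = gauge p by apply/eqP; rewrite eq_le hX leNgt /=; apply/negP; nra.
have eY : Y = gauge q by apply/eqP; rewrite eq_le hY leNgt /=; apply/negP; nra.
have flat r : Num.sqrt (dotv r.1 r.1) = gauge r -> r.2 = 0.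
  move=> er; apply/eqP; rewrite -dotv_eq0.
  have := gauge_sqr2 r; rewrite -er sqr_sqrtr ?dotv_ge0 // /gauge4; lra.
have p2 := flat _ eX; have q2 := flat _ eY.
have x0 : 0 < X by rewrite eX.
have y0 : 0 < Y by rewrite eY.
(* With zero vertical parts, the fourth power of [e] reads (<x,y> - XY)(X^2 + Y^2) = X^2 Y^2 -
   M(x,y), which is nonnegative; Cauchy-Schwarz gives the other inequality. *)
have eP : dotv p.1 q.1 = X * Y.
  have := congr1 (fun a => (a ^+ 2) ^+ 2) e.
  rewrite /= gauge_sqr2 gauge4_gmul /gauge4 p2 q2 addr0 !dotv0l -eX -eY -X2 -Y2.
  have := pairing_le p.1 q.1; rewrite -X2 -Y2.
  move=> h1 h2.
  have h3 : (dotv p.1 q.1 - X * Y) * (X ^+ 2 + Y ^+ 2) >= 0 by lra.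
  have XY0 : 0 < X ^+ 2 + Y ^+ 2 by rewrite addr_gt0 ?exprn_gt0.
  have h4 : 0 <= dotv p.1 q.1 - X * Y by rewrite -(pmulr_lge0 _ XY0).
  have := dotv_CS p.1 q.1; rewrite -X2 -Y2.
  rewrite -exprMn => h5; apply/eqP; rewrite eq_le -[_ * _ <= _]subr_ge0 h4 andbT.
  rewrite (le_trans (ler_norm _)) // -ler_sqr ?nnegrE ?mulr_ge0 //.
  by rewrite real_normK ?num_real.
split=> //; first by rewrite -dotv_gt0 -X2 exprn_gt0.
exists (Y / X); first by rewrite divr_gt0.
suff <- : q.1 = (Y / X) *: p.1 by rewrite -q2 -surjective_pairing.
apply/eqP; rewrite -subr_eq0 -dotv_eq0 !dotvL (dotvC q.1) eP -X2 -Y2.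
by apply/eqP; field; rewrite gt_eqF.
Qed.

(** * Inversion *)

(* sigma(x,t) has first component - invdir(x,t) / (|x|^4 + 16|t|^2). *)
Definition invdir p := cliff (dotv p.1 p.1) (- 4 *: p.2) p.1.

Lemma sigma_finE p :
  sigma_fin U p = (- (gauge4 p)^-1 *: invdir p, - (gauge4 p)^-1 *: p.2).
Proof.
rewrite /sigma_fin -/(gauge4 p) !scaleNr; congr (- (_ *: _), _).
rewrite /invdir /cliff JopZ scaleNr; congr (_ - _ *: _).
by rewrite mulmx_suml; apply: eq_bigr => k _; rewrite scalemxAl.
Qed.

Lemma dotv_invdir p : dotv (invdir p) (invdir p) = gauge4 p * dotv p.1 p.1.
Proof. by rewrite cliff_norm !dotvL /gauge4; congr (_ * _); ring. Qed.

Lemma gauge4_sigma p : p != (0, 0) -> gauge4 (sigma_fin U p) = (gauge4 p)^-1.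
Proof.
rewrite -gauge4_eq0 => p0.
rewrite sigma_finE {1}/gauge4 /= !dotvZl !dotvZr dotv_invdir.
have -> : dotv p.2 p.2 = (gauge4 p - dotv p.1 p.1 ^+ 2) / 16.
  by rewrite /gauge4; field.
by field.
Qed.

Lemma sigma_fin_eq0 p : p != (0, 0) -> sigma_fin U p != (0, 0).
Proof.
by move=> p0; rewrite -gauge4_eq0 gauge4_sigma // invr_eq0 gauge4_eq0.
Qed.

(** The inversion changes the sign of t, so the operator in [invdir] becomes, up to scale, the
    conjugate of the one for p, and [cliff_conj] undoes it. *)
Lemma invdir_sigma p : p != (0, 0) ->
  invdir (sigma_fin U p) = - (gauge4 p)^-1 *: p.1.
Proof.
rewrite -gauge4_eq0 => p0.
rewrite {1}/invdir sigma_finE /=.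
set a := gauge4 p in p0 *.
have -> : dotv (- a^-1 *: invdir p) (- a^-1 *: invdir p) = a^-1 * dotv p.1 p.1.
  by rewrite dotvZl dotvZr dotv_invdir -/a; field.
have e : a *: p.1 = cliff (dotv p.1 p.1) (4 *: p.2) (invdir p).
  have := cliff_conj (dotv p.1 p.1) (- 4 *: p.2) p.1.
  rewrite -scaleNr opprK -/(invdir p) => ->; rewrite !dotvL.
  by congr (_ *: _); rewrite /a /gauge4; ring.
have -> : - a^-1 *: p.1 = - a^-1 ^+ 2 *: (a *: p.1).
  by rewrite scalerA; congr (_ *: _); field.
rewrite e /cliff -!scalemxAr !JopZ !scalerDr !scalerA.
by congr (_ *: _ + _ *: _ + _ *: _); ring.
Qed.

Lemma sigma_finK p : p != (0, 0) -> sigma_fin U (sigma_fin U p) = p.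
Proof.
move=> p0; have := p0; rewrite -gauge4_eq0 => a0.
rewrite sigma_finE invdir_sigma // gauge4_sigma // sigma_finE /= !scalerA invrK.
by rewrite mulrNN mulfV // !scale1r -surjective_pairing.
Qed.

(** The terms are grouped for inversion: up to the factor 1/(N(p)N(q))^4, it exchanges [gauge4 p]
    with [gauge4 q] and the last two inner products with each other, and keeps the remaining
    terms. *)
Lemma gauge4_gmulV p q : gauge4 (gmul U (ginv p) q) =
  gauge4 p + gauge4 q + 2 * dotv p.1 p.1 * dotv q.1 q.1 - 32 * dotv p.2 q.2
  + 4 * pairing p.1 q.1 - 4 * dotv (invdir p) q.1 - 4 * dotv p.1 (invdir q).
Proof.
rewrite gauge4_gmul gauge4_ginv /= -[X in pairing X]scaleN1r pairingZl.
rewrite brkNl (dotvC _ (invdir q)) !cliffE (brkC q.1) !dotvL (dotvC q.1 p.1).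
rewrite (brkC p.1) !dotvL; ring.
Qed.

Lemma gauge4_gmulV_sigma p q : p != (0, 0) -> q != (0, 0) ->
  gauge4 (gmul U (ginv (sigma_fin U p)) (sigma_fin U q)) * gauge4 p * gauge4 q =
  gauge4 (gmul U (ginv p) q).
Proof.
move=> p0 q0; rewrite !gauge4_gmulV !gauge4_sigma // !invdir_sigma //.
have := p0; have := q0; rewrite -!gauge4_eq0 => b0 a0.
rewrite !sigma_finE /=.
have -> : pairing (- (gauge4 p)^-1 *: invdir p) (- (gauge4 q)^-1 *: invdir q) =
    (gauge4 p * gauge4 q)^-1 * pairing p.1 q.1.
  rewrite pairingZl pairingC pairingZl pairingC pairing_cliff2.
  have e r : dotv r.1 r.1 ^+ 2 + dotv (- 4 *: r.2) (- 4 *: r.2) = gauge4 r.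
    by rewrite !dotvL /gauge4; ring.
  rewrite !e; move: (gauge4 p) (gauge4 q) (pairing _ _) a0 b0 => a b c a0 b0.
  by field; rewrite b0.
rewrite !dotvZl !dotvZr !dotv_invdir.
move: (gauge4 p) (gauge4 q) (pairing _ _) (dotv p.1 p.1) (dotv q.1 q.1) a0 b0.
move: (dotv (invdir p) _) (dotv _ (invdir q)) (dotv p.2 q.2).
move=> a b c d e f g h d0 e0.
have cancel (x y : R) : x != 0 -> - x^-1 * (- x^-1 * (x * y)) = x^-1 * y.
  by move=> x0; field.
by rewrite -!mulrA !cancel // invfM; field; rewrite e0.
Qed.

Lemma dist_sigma p q : p != (0, 0) -> q != (0, 0) ->
  dist U (sigma_fin U p) (sigma_fin U q) * gauge p * gauge q = dist U p q.
Proof.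
move=> p0 q0; apply/esym/gauge_eq; first by rewrite !mulr_ge0 ?gauge_ge0.
by rewrite -gauge4_gmulV_sigma // -!gauge_sqr2 -!exprMn.
Qed.

Lemma gauge_sigma p : p != (0, 0) -> gauge (sigma_fin U p) = (gauge p)^-1.
Proof.
move=> p0; apply: gauge_eq; first by rewrite invr_ge0 gauge_ge0.
by rewrite gauge4_sigma // -gauge_sqr2 !exprVn.
Qed.

(** * Points at infinity and the Ptolemy inequality *)

Lemma wd_sym (a b : ptc R m n) : wd U a b = wd U b a.
Proof. by case: a b => [a|] [b|] //=; rewrite dist_sym. Qed.

Lemma wd_gt0 (a b : ptc R m n) : a <> b -> 0 < wd U a b.
Proof.
case: a b => [a|] [b|] //= h; rewrite dist_gt0.
by apply/eqP => e; case: h; rewrite e.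
Qed.

Lemma similarity_comp (f g : ptc R m n -> ptc R m n) :
  similarity U f -> similarity U g -> similarity U (f \o g).
Proof.
move=> sf sg; elim: sf => [//|a h _|l h l0 _|h _].
- exact: sim_tr.
- exact: sim_dil.
- exact: sim_inv.
Qed.

(* [f] carries [oo] to [w], and [F] is its inverse off [w]. *)
Lemma chart_infinity (w : ptc R m n) :
  exists f (F : ptc R m n -> pt R m n),
  [/\ similarity U f, f None = w,
    forall a, a <> w -> f (Some (F a)) = a &
    forall a c, a <> w -> c <> w ->
      wd U a c = dist U (F a) (F c) * wd U w a * wd U w c].
Proof.
case: w => [p|]; last first.
  (* Factors involving oo are 1, so the identity is a chart; the default (0, 0) is only the value at
     oo = w. *)
  exists id, (fun a => odflt (0, 0) a); split => //; first exact: sim_id.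
    by case.
  by move=> [a|] [c|] //= _ _; rewrite !mulr1.
(* Move p to the origin and invert; oo then goes to the origin. *)
pose F (a : ptc R m n) :=
  if a is Some q then sigma_fin U (gmul U (ginv p) q) else (0, 0).
have F0 (q : pt R m n) : Some q <> Some p -> gmul U (ginv p) q != (0, 0).
  move=> h; rewrite -gauge_eq0 -/(dist U p q) dist_eq0.
  by apply/eqP => e; case: h; rewrite e.
exists (ltrans U p \o (sigma U \o id)), F; split.
- exact/sim_tr/sim_inv/sim_id.
- by rewrite /= gmul0.
- move=> [q|] /= h; last by rewrite eqxx.
  by rewrite (negbTE (sigma_fin_eq0 (F0 _ h))) /= sigma_finK ?F0 // gmulKV.
- move=> [q|] [r|] /= hq hr.
  + by rewrite -(dist_gmul (ginv p)) -dist_sigma ?F0.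
  + by rewrite dist0r gauge_sigma ?F0 // mulr1 mulVf // gauge_eq0 F0.
  + by rewrite dist0l gauge_sigma ?F0 // mulr1 mulVf // gauge_eq0 F0.
  + by rewrite dist0l (eqP (_ : gauge (0, 0) == 0)) ?gauge_eq0 // !mul0r.
Qed.

Lemma chart_infinity_zero (w b : ptc R m n) :
  exists f (F : ptc R m n -> pt R m n),
  [/\ similarity U f, f None = w, F b = (0, 0),
    forall a, a <> w -> f (Some (F a)) = a &
    forall a c, a <> w -> c <> w ->
      wd U a c = dist U (F a) (F c) * wd U w a * wd U w c].
Proof.
have [f [F [sf fw fF cF]]] := chart_infinity w.
exists (f \o (ltrans U (F b) \o id)).
exists (fun a => gmul U (ginv (F b)) (F a)); split.
- by apply: similarity_comp => //; apply/sim_tr/sim_id.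
- by rewrite /= fw.
- exact: gmulVg.
- by move=> a /= aw; rewrite gmulKV fF.
- by move=> a c aw cw; rewrite dist_gmul cF.
Qed.

Lemma ptolemaean : Ptolemaean U.
Proof.
move=> a b c d [ab ac ad [bc bd cd]].
have [_ [F [_ _ _ cF]]] := chart_infinity d.
rewrite (cF a c) // (cF a b) // (cF b c) // !(wd_sym _ d).
have := dist_triangle (F b) (F a) (F c).
have := wd_gt0 ad; have := wd_gt0 bd; have := wd_gt0 cd.
rewrite !(wd_sym _ d).
move: (wd U d a) (wd U d b) (wd U d c) => x y z z0 y0 x0 h.
(* In the chart with d at infinity, all three products of distances carry the common factor xyz. *)
have := ler_wpM2r (ltW (mulr_gt0 (mulr_gt0 x0 y0) z0)) h.
by congr (_ <= _); ring.
Qed.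

(** * Ptolemaean circles *)

Lemma brk_norm x y : dotv (brk U x y) (brk U x y) <= dotv x x * dotv y y.
Proof. by apply: le_trans (pairing_le x y); rewrite lerDr sqr_ge0. Qed.

(** Continuity of a circle is Euclidean, whereas Ptolemy's relation uses [dist]; this and
    [gauge_coercive] connect the two. *)
Lemma dist_cont p e : 0 < e ->
  exists2 d, 0 < d & forall q, edist q p < d -> dist U p q < e.
Proof.
move=> e0; set K := 33 + 8 * dotv p.1 p.1.
have K0 : 0 < K by rewrite /K; have := dotv_ge0 p.1; lra.
have e4 : 0 < (e ^+ 2) ^+ 2 by rewrite !exprn_gt0.
exists (Num.sqrt (Num.min 1 ((e ^+ 2) ^+ 2 / K))).
  by rewrite sqrtr_gt0 lt_min ltr01 divr_gt0.
move=> q; rewrite /edist ltr_sqrt ?lt_min ?ltr01 ?divr_gt0 //.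
rewrite ltr_pdivlMr //.
set x := q.1 - p.1; set t := q.2 - p.2 => /andP[E1 E2].
rewrite -(@ltr_sqr _ (dist _ _ _)) ?nnegrE ?dist_ge0 ?(ltW e0) //.
rewrite -ltr_sqr ?nnegrE ?sqr_ge0 // gauge_sqr2.
have -> : gmul U (ginv p) q = (x, t - 2^-1 *: brk U p.1 x).
  rewrite /gmul /= /x /t brkNl brkDr brkNr brkxx // subr0 scalerN.
  by rewrite (addrC (- p.1)) (addrC (- p.2)).
clearbody x t; apply: le_lt_trans E2; rewrite /gauge4 /= /K.
have := brk_norm p.1 x; have := dotv_ge0 (t + 2^-1 *: brk U p.1 x).
have := dotv_ge0 t; have := dotv_ge0 x; have := dotv_ge0 p.1.
rewrite !dotvL (dotvC _ t).
move: (dotv x x) (dotv t t) (dotv p.1 p.1) (dotv t _) (dotv (brk _ _ _) _) E1.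
move=> X T P B C; nra.
Qed.

(** If N(p) <= M, then 2|x|^2 <= |x|^4 + 1 yields |x|^2 + |t|^2 <= M^4 + 1 <= (M^4 + 1)^2. *)
Lemma gauge_coercive M p : (M ^+ 2) ^+ 2 + 1 < enorm p -> M < gauge p.
Proof.
move=> h; rewrite ltNge; apply/negP => gM.
have M0 : 0 <= M by apply: le_trans gM; exact: gauge_ge0.
have : gauge4 p <= (M ^+ 2) ^+ 2.
  by rewrite -gauge_sqr2 !ler_sqr ?nnegrE ?sqr_ge0 ?gauge_ge0.
have e2 : enorm p ^+ 2 = dotv p.1 p.1 + dotv p.2 p.2.
  by rewrite sqr_sqrtr // addr_ge0 ?dotv_ge0.
move: h; rewrite /gauge4; move: (dotv_ge0 p.2) (sqr_ge0 (dotv p.1 p.1 - 1)) e2.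
move: (sqr_ge0 (M ^+ 2)).
move: (dotv p.1 p.1) (dotv p.2 p.2) (enorm p) ((M ^+ 2) ^+ 2) => X T E N.
nra.
Qed.

Lemma wd_lipschitz (b : ptc R m n) p q :
  wd U b (Some q) <= wd U b (Some p) + dist U p q.
Proof.
case: b => [b|] /=; first exact: dist_triangle.
by rewrite lerDl dist_ge0.
Qed.

(* The condition is open also where [g a] is [oo], although [wd] is discontinuous
   there. *)
Lemma pencil_gt0_open (g : R -> ptc R m n) (b w : ptc R m n) (u v a : R) :
  cont_at g a -> 0 < u -> 0 < v -> v * wd U w (g a) < u * wd U b (g a) ->
  exists2 d : R, 0 < d &
    forall s' : R, `|s' - a| < d -> v * wd U w (g s') < u * wd U b (g s').
Proof.
rewrite /cont_at => gs u0 v0; case: (g a) gs => [p|] gs.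
  (* Moving the point by less than [e] changes the two sides by less than u e and v e, together less
     than the gap. *)
  move=> h; pose e := (u * wd U b (Some p) - v * wd U w (Some p)) / (u + v).
  have uv0 : 0 < u + v by rewrite addr_gt0.
  have e0 : 0 < e by rewrite divr_gt0 // subr_gt0.
  have eE : e * (u + v) = u * wd U b (Some p) - v * wd U w (Some p).
    by rewrite /e divfK // gt_eqF.
  have [d' d'0 hd'] := dist_cont p e0.
  have [d d0 hd] := gs _ d'0.
  exists d => // s' /hd [q [-> /hd' pq]].
  have := wd_lipschitz b q p; have := wd_lipschitz w p q; rewrite (dist_sym q).
  move: (wd U b _) (wd U w _) (wd U b _) (wd U w _) eE pq => B W B' W'.
  move: (dist U p q) => D; nra.
(* Now [g a] is oo, so the hypothesis forces [b] to be finite, and v < u if [w] is finite too. Far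
   out, the gauge of q exceeds the threshold at which u(N(q) - N(b)) beats v(N(q) + N(w)), or v if
   [w] is oo. *)
case: b => [b|] /=; last by case: w => [w|] /=; nra.
have far q : gauge q - gauge b <= dist U b q.
  by have := dist_triangle b (0, 0) q; rewrite dist0l dist0l; lra.
case: w => [w|] /= h.
  have [d d0 hd] := gs (((u * gauge b + v * gauge w) / (u - v)) ^+ 2 ^+ 2 + 1).
  exists d => // s' /hd; case: (g s') => [q|] //= /gauge_coercive.
  rewrite ltr_pdivrMr; last by lra.
  have := dist_triangle (0, 0) w q; have := far q; rewrite dist0l dist0r.
  nra.
have [d d0 hd] := gs (((u * gauge b + v) / u) ^+ 2 ^+ 2 + 1).
exists d => // s' /hd; case: (g s') => [q|] /=; last by lra.
by move/gauge_coercive; rewrite ltr_pdivrMr //; have := far q; nra.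
Qed.

Lemma dist_add_eq p q : p != (0, 0) -> q != (0, 0) ->
  dist U p q = gauge p + gauge q ->
  [/\ p.2 = 0, p.1 != 0 & exists2 c, 0 < c & q = (- c *: p.1, 0)].
Proof.
rewrite -!gauge_gt0 -(gauge_ginv p) !gauge_gt0 => p0 q0 e.
have [/= /eqP] := gauge_gmul_eq p0 q0 e.
rewrite !oppr_eq0 => /eqP -> x0 [c c0 ->]; split => //.
by exists c => //; rewrite scalerN scaleNr.
Qed.

(** Both sign conditions are open by [pencil_gt0_open], the negative one after exchanging b with w
    and u with v. *)
Lemma pencil_ivt (g : R -> ptc R m n) (b w : ptc R m n) (u v a1 a2 : R) :
  (forall a, cont_at g a) -> 0 < u -> 0 < v -> a1 < a2 ->
  u * wd U b (g a1) < v * wd U w (g a1) ->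
  v * wd U w (g a2) < u * wd U b (g a2) ->
  exists2 a, a1 < a < a2 & u * wd U b (g a) = v * wd U w (g a).
Proof.
move=> gc u0 v0 a12 h1 h2.
have [||a|a|a aa /eqP] := @sign_ivt R
    (fun a => u * wd U b (g a) - v * wd U w (g a)) a1 a2 a12.
- by rewrite subr_lt0.
- by rewrite subr_gt0.
- rewrite subr_gt0 => /(pencil_gt0_open (gc a) u0 v0) [d d0 hd].
  by exists d => // a' /hd; rewrite subr_gt0.
- rewrite subr_lt0 => /(pencil_gt0_open (gc a) v0 u0) [d d0 hd].
  by exists d => // a' /hd; rewrite subr_lt0.
- by rewrite subr_eq0 => /eqP; exists a.
Qed.

Lemma wd_refl (a : ptc R m n) : wd U a a = 0.
Proof. by case: a => [a|] //=; apply/eqP; rewrite dist_eq0. Qed.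

Lemma ptolemaean_circle_Rcircle (S : ptc R m n -> Prop) :
  ptolemaean_circle U S -> Rcircle U S.
Proof.
have [c1 l1] : exists c : R, 0 < c < 2^-1 by exists 4^-1; lra.
have [c3 l2] : exists c : R, 2^-1 < c < 1 by exists (3 / 4); lra.
case=> g [[gper gcont ginj gS] geq].
have i0 : in01 (0 : R) by rewrite /in01 lexx ltr01.
have ih : in01 (2^-1 : R) by rewrite /in01; lra.
have gneq (a a' : R) : in01 a -> in01 a' -> a < a' -> g a <> g a'.
  by move=> ha ha' + e; rewrite (ginj _ _ ha ha' e) ltxx.
have wb : g 0 <> g 2^-1 by apply: gneq => //; lra.
set w := g 0 in wb *; set b := g 2^-1 in wb *.
have [f [F [sf fw Fb fF cF]]] := chart_infinity_zero w b.
pose q a := F (g a).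
have open01 (a : R) : 0 < a < 1 -> in01 a /\ g a <> w.
  move=> ha; have h : in01 a by rewrite /in01; lra.
  by split => //; apply/nesym/gneq => //; lra.
have gauge_q (a : R) : 0 < a < 1 ->
    wd U b (g a) = gauge (q a) * wd U w b * wd U w (g a).
  by move=> /open01[_ aw]; rewrite (cF b) //; [rewrite Fb dist0l|exact/nesym].
have wb0 := wd_gt0 wb.
have q_neq0 (a : R) : 0 < a < 1 -> a != 2^-1 -> q a != (0, 0).
  move=> ha ah; rewrite -gauge_gt0.
  have [ia aw] := open01 _ ha.
  have : b <> g a by move=> e; move: ah; rewrite (ginj _ _ ih ia e) eqxx.
  by move/wd_gt0; rewrite gauge_q // !pmulr_lgt0 //; apply/wd_gt0/nesym.
have q_add (a a' : R) : 0 < a < 2^-1 -> 2^-1 < a' < 1 ->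
    dist U (q a) (q a') = gauge (q a) + gauge (q a').
  move=> ha ha'.
  have [ia aw] : in01 a /\ g a <> w by apply: open01; lra.
  have [ia' aw'] : in01 a' /\ g a' <> w by apply: open01; lra.
  (* The parameters a and a' separate 1/2 from 0; with g(0) at infinity and g(1/2) at the origin,
     Ptolemy's equality becomes additivity of the gauge. *)
  have d4 : distinct4 (g a) (g 2^-1) (g a') (g 0).
    split; [by apply: gneq => //; lra|by apply: gneq => //; lra|exact: aw|].
    by split; [by apply: gneq => //; lra|exact/nesym|].
  have sep : separates a 2^-1 a' 0.
    have aa : a <= a' by lra.
    case/andP: ha ha' => a_gt0 a_lt /andP[a'_gt _].
    by rewrite /separates min_l // max_r // a_lt a'_gt (lt_gtF a_gt0).
  have := geq _ _ _ _ ia ih ia' i0 d4 sep.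
  rewrite -/w -/b (wd_sym (g a) b) !(wd_sym _ w) !gauge_q; [|lra|lra].
  rewrite (cF (g a)) // -/(q a) -/(q a').
  have := wd_gt0 (nesym aw); have := wd_gt0 (nesym aw').
  move: (wd U w (g a)) (wd U w (g a')) (wd U w b) wb0 => A A' B B0 A'0 A0 e.
  apply: (@mulfI _ (A * A' * B)); first by rewrite !mulf_neq0 // gt_eqF.
  by move: e; congr (_ = _); ring.
have q_addC (a a' : R) : 0 < a < 2^-1 -> 2^-1 < a' < 1 ->
    dist U (q a') (q a) = gauge (q a') + gauge (q a).
  by move=> ha ha'; rewrite dist_sym q_add // addrC.
have q1_neq0 : q c1 != (0, 0) by apply: q_neq0; rewrite ?lt_eqF //; lra.
have q3_neq0 : q c3 != (0, 0) by apply: q_neq0; rewrite ?gt_eqF //; lra.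
have [_ x0 _] := dist_add_eq q3_neq0 q1_neq0 (q_addC _ _ l1 l2).
(* The sample [q c3] fixes the direction of the line: the first half lies on the ray opposite to it,
   the second half on the ray opposite to [q c1]. *)
set x := (q c3).1 in x0.
have q_low (a : R) : 0 < a < 2^-1 -> exists2 c, 0 < c & q a = (- c *: x, 0).
  move=> ha; have qa : q a != (0, 0) by apply: q_neq0; rewrite ?lt_eqF //; lra.
  by have [] := dist_add_eq q3_neq0 qa (q_addC _ _ ha l2).
have q_high (a : R) : 2^-1 < a < 1 -> exists2 c, 0 < c & q a = (c *: x, 0).
  move=> ha; have qa : q a != (0, 0) by apply: q_neq0; rewrite ?gt_eqF //; lra.
  have [_ _ [c c0 ->]] := dist_add_eq q1_neq0 qa (q_add _ _ l1 ha).
  have [c' c'0 ->] := q_low _ l1.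
  by exists (c * c'); rewrite ?mulr_gt0 //= scalerA mulrNN.
have gauge_line (c : R) :
    gauge (c *: x, 0 : 'cV[R]_n) = `|c| * Num.sqrt (dotv x x).
  apply: gauge_eq; first by rewrite mulr_ge0 ?sqrtr_ge0.
  rewrite /gauge4 /= !dotvL dotv0l [X in _ = X ^+ 2]exprMn.
  by rewrite real_normK ?num_real // sqr_sqrtr ?dotv_ge0 //; ring.
have X0 : 0 < Num.sqrt (dotv x x) by rewrite sqrtr_gt0 dotv_gt0.
have g1 : g 1 = w by rewrite -[1]add0r gper.
have onto_high (l : R) : 0 < l -> exists2 a, 2^-1 < a < 1 & q a = (l *: x, 0).
  (* By [gauge_q], d(b, g a) = v d(w, g a) says that [q a] has gauge l|x|. The left side vanishes at
     1/2, the right side at 1, where g returns to w. *)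
  move=> l0; pose v := l * Num.sqrt (dotv x x) * wd U w b.
  have v0 : 0 < v by rewrite !mulr_gt0.
  have [|||a ha] := @pencil_ivt g b w 1 v 2^-1 1 gcont ltr01 v0.
  - lra.
  - by rewrite -/b wd_refl mulr0 mulr_gt0.
  - by rewrite g1 wd_refl mulr0 mul1r wd_sym.
  have h01 : 0 < a < 1 by lra.
  have [_ aw] := open01 _ h01.
  have W0 := wd_gt0 (nesym aw).
  have [c c0 qa] := q_high _ ha.
  rewrite mul1r gauge_q // qa gauge_line gtr0_norm // => /(mulIf _) e.
  exists a; rewrite // qa.
  have := e (lt0r_neq0 W0).
  by rewrite /v => /(mulIf (lt0r_neq0 wb0)) /(mulIf (lt0r_neq0 X0)) ->.
have onto_low (l : R) : 0 < l -> exists2 a, 0 < a < 2^-1 & q a = (- l *: x, 0).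
  move=> l0; pose v := l * Num.sqrt (dotv x x) * wd U w b.
  have v0 : 0 < v by rewrite !mulr_gt0.
  (* The roles of b and w are exchanged, because on this half the curve starts at w and ends at
     b. *)
  have [|||a ha] := @pencil_ivt g w b v 1 0 2^-1 gcont v0 ltr01.
  - lra.
  - by rewrite -/w wd_refl mulr0 mul1r wd_sym.
  - by rewrite -/b wd_refl mulr0 mulr_gt0.
  have h01 : 0 < a < 1 by lra.
  have [_ aw] := open01 _ h01.
  have W0 := wd_gt0 (nesym aw).
  have [c c0 qa] := q_low _ ha.
  rewrite mul1r gauge_q // qa gauge_line normrN gtr0_norm // => /(mulIf _) e.
  exists a; rewrite // qa.
  have := e (lt0r_neq0 W0).
  by rewrite /v => /(mulIf (lt0r_neq0 wb0)) /(mulIf (lt0r_neq0 X0)) ->.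
exists f, x; split=> // r; rewrite gS; split.
  case=> a [/andP[a0 a1] <-].
  have [->|an0] := eqVneq a 0; first by exists None; split; [left|].
  have ha : 0 < a < 1 by lra.
  have [_ aw] := open01 _ ha.
  exists (Some (q a)); split; last exact: fF.
  right; case: (ltgtP a 2^-1) => [h|h|->].
  - by have [|c _ ->] := q_low a; [lra|exists (- c)].
  - by have [|c _ ->] := q_high a; [lra|exists c].
  - by exists 0; rewrite /q -/b Fb scale0r.
case=> p [[->|[l ->]] <-]; first by exists 0; rewrite fw; split.
case: (ltgtP l 0) => [l0|l0|->].
- have [|a ha qa] := onto_low (- l); first by lra.
  exists a; split; first by lra.
  have [|_ aw] := open01 a; first by lra.
  by rewrite -(opprK l) -qa fF.
- have [a ha qa] := onto_high _ l0.
  exists a; split; first by lra.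
  have [|_ aw] := open01 a; first by lra.
  by rewrite -qa fF.
- exists 2^-1; split=> //.
  by rewrite scale0r -Fb fF //; exact/nesym.
Qed.

End Algebra.

Theorem theorem1 (R : realType) (m n : nat) (U : 'I_n -> 'M[R]_m) :
  HtypeIwasawa U ->
  Ptolemaean U /\
  (forall S : ptc R m n -> Prop, ptolemaean_circle U S -> Rcircle U S).
Proof.
move=> HU; split; first exact: ptolemaean.
exact: ptolemaean_circle_Rcircle.
Qed.
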